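(* Every regular BiHom-alternative algebra $(A,\mu,\alpha,\beta)$ is BiHom-Jordan-admissible; that is, its plus BiHom-algebra $A^+=(A,\ast,\alpha,\beta)$, with $x\ast y=\frac12\big(\mu(x,y)+\mu(\alpha^{-1}\beta(y),\alpha\beta^{-1}(x))\big)$, is a BiHom-Jordan algebra.
   Context: All vector spaces are over an algebraically closed field $\mathbb{K}$ of characteristic $0$. For a quadruple $(A,\mu,\alpha,\beta)$ with $\mu:A\otimes A\to A$, $\alpha,\beta:A\to A$ linear, the BiHom-associator is $as_{\alpha,\beta}(x,y,z)=\mu(\mu(x,y),\beta(z))-\mu(\alpha(x),\mu(y,z))$. A BiHom-alternative algebra is such a quadruple with $\alpha\beta=\beta\alpha$, $\alpha\mu=\mu\alpha^{\otimes 2}$, $\beta\mu=\mu\beta^{\otimes 2}$ and, for all $x,y,z\in A$, $as_{\alpha,\beta}(\beta(x),\alpha(y),z)+as_{\alpha,\beta}(\beta(y),\alpha(x),z)=0$ and $as_{\alpha,\beta}(x,\beta(y),\alpha(z))+as_{\alpha,\beta}(x,\beta(z),\alpha(y))=0$. It is regular if $\alpha$ and $\beta$ are algebra automorphisms. A BiHom-Jordan algebra is a quadruple $(A,\mu,\alpha,\beta)$ such that for all $x,y\in A$: (i) $\alpha\beta=\beta\alpha$; (ii) $\mu(\beta(x),\alpha(y))=\mu(\beta(y),\alpha(x))$; (iii) $as_{\alpha,\beta}\big(\mu(\beta^2(x),\alpha\beta(x)),\alpha^2\beta(y),\alpha^3(x)\big)=0$, where $as_{\alpha,\beta}$ is formed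 with the multiplication of the algebra in question. *)

(* Defs.v *)
From HB Require Import structures.
From mathcomp Require Import all_boot all_order all_algebra.

Set Implicit Arguments.
Unset Strict Implicit.
Unset Printing Implicit Defensive.

Import GRing.Theory.
Local Open Scope ring_scope.

Record bihomAlg (K : closedFieldType) := BihomAlg {
  carrier :> lmodType K;
  bmul : {bilinear carrier -> carrier -> carrier};
  balpha : {linear carrier -> carrier};
  bbeta : {linear carrier -> carrier}
}.

Definition bihom_as (K : closedFieldType) (A : bihomAlg K) (x y z : A) : A :=
  bmul A (bmul A x y) (bbeta A z) - bmul A (balpha A x) (bmul A y z).

Definition multiplicative_map (K : closedFieldType) (A : bihomAlg K)
    (f : A -> A) : Prop :=
  forall x y : A, f (bmul A x y) = bmul A (f x) (f y).

Record bihom_alternative (K : closedFieldType) (A : bihomAlg K) : Prop := {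
  alt_comm : forall x : A, balpha A (bbeta A x) = bbeta A (balpha A x);
  alt_alphaM : multiplicative_map (balpha A);
  alt_betaM : multiplicative_map (bbeta A);
  alt_left : forall x y z : A,
    bihom_as (bbeta A x) (balpha A y) z
    + bihom_as (bbeta A y) (balpha A x) z = 0;
  alt_right : forall x y z : A,
    bihom_as x (bbeta A y) (balpha A z)
    + bihom_as x (bbeta A z) (balpha A y) = 0
}.

Definition algebra_automorphism (K : closedFieldType) (A : bihomAlg K)
    (f : {linear A -> A}) : Prop :=
  bijective f /\ multiplicative_map f.

Record bihom_regular (K : closedFieldType) (A : bihomAlg K) : Prop := {
  regular_alpha : algebra_automorphism (balpha A);
  regular_beta : algebra_automorphism (bbeta A)
}.

(* Multiplicativity of [balpha] and [bbeta] is deliberately not part of this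
   definition. *)
Record bihom_Jordan (K : closedFieldType) (A : bihomAlg K) : Prop := {
  jordan_comm : forall x : A, balpha A (bbeta A x) = bbeta A (balpha A x);
  jordan_sym : forall x y : A,
    bmul A (bbeta A x) (balpha A y) = bmul A (bbeta A y) (balpha A x);
  jordan_id : forall x y : A,
    bihom_as
      (bmul A (bbeta A (bbeta A x)) (balpha A (bbeta A x)))
      (balpha A (balpha A (bbeta A y)))
      (balpha A (balpha A (balpha A x))) = 0
}.

Lemma bij_preimage (T : choiceType) (f : T -> T) (fbij : bijective f) (y : T) :
  exists x, f x == y.
Proof. by case: fbij => g _ gK; exists (g y); rewrite gK. Qed.

(* [bijective] is a proposition, so its witness cannot be projected out;
   choice on [T] picks the unique preimage. *)
Definition bij_inv (T : choiceType) (f : T -> T) (fbij : bijective f) : T -> T :=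
  fun y => xchoose (bij_preimage fbij y).

Lemma bij_invKr (T : choiceType) (f : T -> T) (fbij : bijective f) :
  cancel (bij_inv fbij) f.
Proof. by move=> y; apply/eqP; exact: (xchooseP (bij_preimage fbij y)). Qed.

Lemma bij_invK (T : choiceType) (f : T -> T) (fbij : bijective f) :
  cancel f (bij_inv fbij).
Proof. by move=> x; apply: (bij_inj fbij); rewrite bij_invKr. Qed.

Lemma bij_inv_is_linear (K : closedFieldType) (V : lmodType K)
    (f : {linear V -> V}) (fbij : bijective f) : linear (bij_inv fbij).
Proof.
by move=> a u v; apply: (bij_inj fbij); rewrite linearP !bij_invKr.
Qed.

HB.instance Definition _ (K : closedFieldType) (V : lmodType K)
    (f : {linear V -> V}) (fbij : bijective f) :=
  GRing.isLinear.Build K V V *:%R (bij_inv fbij) (bij_inv_is_linear fbij).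

Definition alpha_inv (K : closedFieldType) (A : bihomAlg K)
    (Areg : bihom_regular A) : {linear A -> A} :=
  bij_inv (proj1 (regular_alpha Areg)).

Definition beta_inv (K : closedFieldType) (A : bihomAlg K)
    (Areg : bihom_regular A) : {linear A -> A} :=
  bij_inv (proj1 (regular_beta Areg)).

Definition plus_mul (K : closedFieldType) (A : bihomAlg K)
    (Areg : bihom_regular A) (x y : A) : A :=
  2^-1 *: (bmul A x y
           + bmul A (alpha_inv Areg (bbeta A y)) (balpha A (beta_inv Areg x))).

Lemma plus_mul_is_bilinear (K : closedFieldType) (A : bihomAlg K)
    (Areg : bihom_regular A) :
  bilinear_for *:%R *:%R (plus_mul Areg).
Proof.
split=> u a x y /=; rewrite /plus_mul !linearP linearPl /= ?linearPr;
  rewrite ?linearP ?linearPl scalerA mulrC -scalerA -scalerDr; congr (_ *: _);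
  by rewrite scalerDr addrACA.
Qed.

HB.instance Definition _ (K : closedFieldType) (A : bihomAlg K)
    (Areg : bihom_regular A) :=
  bilinear_isBilinear.Build K A A A *:%R *:%R (plus_mul Areg)
    (plus_mul_is_bilinear Areg).

Definition plus_alg (K : closedFieldType) (A : bihomAlg K)
    (Areg : bihom_regular A) : bihomAlg K :=
  @BihomAlg K A (plus_mul Areg) (balpha A) (bbeta A).

Definition bihom_Jordan_admissible (K : closedFieldType) (A : bihomAlg K)
    (Areg : bihom_regular A) : Prop :=
  bihom_Jordan (plus_alg Areg).

(* Main.v *)
(* Untwisting: [x . y := mu (alpha^-1 x) (beta^-1 y)] is an ordinary alternative
   product, because [as_(alpha,beta) (x, y, z)] is the ordinary associator of
   [(alpha^2 x, alpha beta y, beta^2 z)].  In the same way [x * y] is half of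
   the anticommutator of [alpha x] and [beta y] for this product, so the
   BiHom-Jordan identity at [(x, y)] is the Jordan identity of the untwisted
   algebra at [(alpha^3 beta^2 x, alpha^3 beta^2 y)].  It remains to use that
   alternative algebras are Jordan-admissible in characteristic not 2. *)
Require Import Defs.
From HB Require Import structures.
From mathcomp Require Import all_boot all_order all_algebra.

Set Implicit Arguments.
Unset Strict Implicit.
Unset Printing Implicit Defensive.

Import GRing.Theory.
Local Open Scope ring_scope.

Definition associator (K : fieldType) (V : lmodType K)
    (m : {bilinear V -> V -> V}) (x y z : V) : V := m (m x y) z - m x (m y z).

(** The laws are stated in linearised form, the shape that [alt_left] and [alt_right] take once
    untwisted; setting two arguments equal recovers the usual laws after division by 2. *)
Record alternative (K : fieldType) (V : lmodType K)
    (m : {bilinear V -> V -> V}) : Prop := {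
  assocC12 : forall x y z, associator m x y z + associator m y x z = 0;
  assocC23 : forall x y z, associator m x y z + associator m x z y = 0
}.

(** The factor 1/2 of the Jordan product is left out, which keeps the Jordan identity free of
    scalars. *)
Definition anticomm (K : fieldType) (V : lmodType K)
    (m : {bilinear V -> V -> V}) (x y : V) : V := m x y + m y x.

Lemma addrr_eq0 (K : fieldType) (V : lmodType K) (v : V) :
  2 != 0 :> K -> v + v = 0 -> v = 0.
Proof.
move=> two_neq0; rewrite -mulr2n -scaler_nat => /eqP.
by rewrite scaler_eq0 (negPf two_neq0) => /eqP.
Qed.

Lemma half_addrr (K : fieldType) (V : lmodType K) (v : V) :
  2 != 0 :> K -> 2^-1 *: (v + v) = v.
Proof.
by move=> two_neq0; rewrite -mulr2n -scaler_nat scalerA mulVf // scale1r.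
Qed.

Lemma anticommZl (K : fieldType) (V : lmodType K) (m : {bilinear V -> V -> V})
  c x y : anticomm m (c *: x) y = c *: anticomm m x y.
Proof. by rewrite /anticomm linearZl_LR linearZ scalerDr. Qed.

Lemma anticommZr (K : fieldType) (V : lmodType K) (m : {bilinear V -> V -> V})
  c x y : anticomm m x (c *: y) = c *: anticomm m x y.
Proof. by rewrite /anticomm linearZl_LR linearZ scalerDr. Qed.

Section Alternative.

Context (K : fieldType) (two_neq0 : 2 != 0 :> K) (V : lmodType K).
Context (m : {bilinear V -> V -> V}) (m_alt : alternative m).

Lemma alt_mulxx_l x y : m (m x x) y = m x (m x y).
Proof.
by apply/eqP; rewrite -subr_eq0; apply/eqP/(addrr_eq0 two_neq0)/(assocC12 m_alt).
Qed.

Lemma alt_mulxx_r x y : m (m y x) x = m y (m x x).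
Proof.
by apply/eqP; rewrite -subr_eq0; apply/eqP/(addrr_eq0 two_neq0)/(assocC23 m_alt).
Qed.

(* Both [(y, x, x^2)] and [(y, x^2, x)] equal [y x x x - y x^3], yet they are
   opposite. *)
Lemma assoc_sq_r x y : associator m y x (m x x) = 0.
Proof.
have eq_assoc : associator m y x (m x x) = associator m y (m x x) x.
  by rewrite /associator -!alt_mulxx_r alt_mulxx_l.
by apply: (addrr_eq0 two_neq0); rewrite {2}eq_assoc (assocC23 m_alt).
Qed.

Lemma assoc_sq_l x y : associator m y (m x x) x = 0.
Proof. by rewrite -(assocC23 m_alt y x (m x x)) assoc_sq_r add0r. Qed.

(** Each side expands into four products, which agree in pairs. Two pairs agree because the
    associators of (x, y, x^2) and (x^2, y, x) vanish, the other two because left (right)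
    multiplication by x^2 is the square of that by x. *)
Lemma alternative_Jordan x y :
  anticomm m (anticomm m (m x x) y) x = anticomm m (m x x) (anticomm m y x).
Proof.
have exxy : m (m x y) (m x x) = m x (m y (m x x)).
  apply/eqP; rewrite -subr_eq0; apply/eqP.
  by move: (assocC12 m_alt x y (m x x)); rewrite assoc_sq_r addr0.
have exyx : m (m (m x x) y) x = m (m x x) (m y x).
  apply/eqP; rewrite -subr_eq0; apply/eqP.
  by move: (assocC12 m_alt (m x x) y x); rewrite assoc_sq_l addr0.
have exxy' : m x (m (m x x) y) = m (m x x) (m x y).
  by rewrite [m (m x x) y]alt_mulxx_l -alt_mulxx_l.
have eyxx : m (m y (m x x)) x = m (m y x) (m x x).
  by rewrite -[m y (m x x)]alt_mulxx_r alt_mulxx_r.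
by rewrite /anticomm !linearDl !linearDr /= exyx exxy exxy' eyxx addrACA.
Qed.

End Alternative.

Definition untwisted (K : closedFieldType) (A : bihomAlg K)
    (Areg : bihom_regular A) (x y : A) : A :=
  bmul A (alpha_inv Areg x) (beta_inv Areg y).

Lemma untwisted_is_bilinear (K : closedFieldType) (A : bihomAlg K)
    (Areg : bihom_regular A) :
  bilinear_for *:%R *:%R (untwisted Areg).
Proof. by split=> z c x y; rewrite /untwisted linearP ?linearPl ?linearPr. Qed.

HB.instance Definition _ (K : closedFieldType) (A : bihomAlg K)
    (Areg : bihom_regular A) :=
  bilinear_isBilinear.Build K A A A *:%R *:%R (untwisted Areg)
    (untwisted_is_bilinear Areg).

Section Untwisting.

Context (K : closedFieldType) (A : bihomAlg K).
Context (Aalt : bihom_alternative A) (Areg : bihom_regular A).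

Local Notation m := (untwisted Areg : {bilinear A -> A -> A}).

Lemma alpha_invK : cancel (balpha A) (alpha_inv Areg).
Proof. exact: bij_invK. Qed.

Lemma alpha_invKr : cancel (alpha_inv Areg) (balpha A).
Proof. exact: bij_invKr. Qed.

Lemma beta_invK : cancel (bbeta A) (beta_inv Areg).
Proof. exact: bij_invK. Qed.

Lemma beta_invKr : cancel (beta_inv Areg) (bbeta A).
Proof. exact: bij_invKr. Qed.

Lemma alpha_beta_inv x : balpha A (beta_inv Areg x) = beta_inv Areg (balpha A x).
Proof. by apply: (can_inj beta_invK); rewrite -(alt_comm Aalt) !beta_invKr. Qed.

Lemma beta_alpha_inv x : bbeta A (alpha_inv Areg x) = alpha_inv Areg (bbeta A x).
Proof. by apply: (can_inj alpha_invK); rewrite (alt_comm Aalt) !alpha_invKr. Qed.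

Lemma untwistedE x y : m x y = bmul A (alpha_inv Areg x) (beta_inv Areg y).
Proof. by []. Qed.

Lemma bmulE x y : bmul A x y = m (balpha A x) (bbeta A y).
Proof. by rewrite untwistedE alpha_invK beta_invK. Qed.

Lemma alpha_untwisted x y : balpha A (m x y) = m (balpha A x) (balpha A y).
Proof.
by rewrite !untwistedE (alt_alphaM Aalt) alpha_invKr alpha_invK alpha_beta_inv.
Qed.

Lemma beta_untwisted x y : bbeta A (m x y) = m (bbeta A x) (bbeta A y).
Proof.
by rewrite !untwistedE (alt_betaM Aalt) beta_invKr beta_invK beta_alpha_inv.
Qed.

Lemma bihom_asE x y z :
  bihom_as x y z = associator m (balpha A (balpha A x))
    (balpha A (bbeta A y)) (bbeta A (bbeta A z)).
Proof.
rewrite /bihom_as /associator !bmulE alpha_untwisted beta_untwisted.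
by rewrite (alt_comm Aalt).
Qed.

Lemma untwisted_alternative : alternative m.
Proof.
pose a := alpha_inv Areg; pose b := beta_inv Areg.
have aK : cancel a (balpha A) := alpha_invKr.
have bK : cancel b (bbeta A) := beta_invKr.
split=> x y z.
  (* In both summands [bihom_asE] applies alpha^2 beta to the first two variables and beta^2 to the
     third; these preimages cancel that. In [alt_right] the twists are alpha^2, alpha beta^2 and
     alpha beta^2. *)
  have := alt_left Aalt (b (a (a x))) (b (a (a y))) (b (b z)).
  by rewrite !bihom_asE -!(alt_comm Aalt) !bK !aK.
have := alt_right Aalt (a (a x)) (b (b (a y))) (b (b (a z))).
by rewrite !bihom_asE -!(alt_comm Aalt) !bK !aK.
Qed.

(** The twists in the second summand of [plus_mul] cancel to leave the opposite product of
    [balpha A x] and [bbeta A y]. *)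
Lemma plus_mulE x y :
  plus_mul Areg x y = 2^-1 *: anticomm m (balpha A x) (bbeta A y).
Proof.
by rewrite /plus_mul /anticomm !bmulE alpha_invKr alpha_beta_inv beta_invKr.
Qed.

Lemma alpha_anticomm x y :
  balpha A (anticomm m x y) = anticomm m (balpha A x) (balpha A y).
Proof. by rewrite linearD /= !alpha_untwisted. Qed.

Lemma beta_anticomm x y :
  bbeta A (anticomm m x y) = anticomm m (bbeta A x) (bbeta A y).
Proof. by rewrite linearD /= !beta_untwisted. Qed.

End Untwisting.

Theorem theorem4p2 (K : closedFieldType) (char0 : [pchar K] =i pred0)
    (A : bihomAlg K) (Aalt : bihom_alternative A) (Areg : bihom_regular A) :
  bihom_Jordan_admissible Areg.
Proof.
have two_neq0 : 2 != 0 :> K by rewrite (iffLR (pcharf0P K) char0).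
split=> [x|x y|x y]; first exact: (alt_comm Aalt).
  (* Both sides become half the anticommutator of alpha beta x and alpha beta y, in opposite
     orders. *)
  rewrite /= !(plus_mulE Aalt) !(alt_comm Aalt).
  by congr (_ *: _); exact: addrC.
rewrite /bihom_as /= !(plus_mulE Aalt) -!(alt_comm Aalt).
(* Both factors of the inner product beta^2 x * alpha beta x untwist to this element, so that
   product is the plain square of [u]. *)
set u := balpha A (bbeta A (bbeta A x)).
have -> : 2^-1 *: anticomm (untwisted Areg) u u = untwisted Areg u u.
  exact: half_addrr.
rewrite !linearZ /= !(alpha_anticomm Aalt) !(beta_anticomm Aalt).
rewrite !(alpha_untwisted Aalt) -!(alt_comm Aalt) -/u.
rewrite anticommZl anticommZr scalerN; apply/eqP; rewrite subr_eq0; apply/eqP.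
(* Both sides carry the same factor 1/4, and every copy of x now occurs as alpha^2 u = alpha^3
   beta^2 x. *)
congr (_ *: (_ *: _)); apply: (alternative_Jordan two_neq0).
exact: untwisted_alternative.
Qed.
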